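(* Let $G_1$ be a finite simple graph with $n_1$ vertices that is $k_1$-regular, and let $G_2$ be a finite simple graph with maximum degree at most $k_2$ and minimum degree at least one ($G_1$ and $G_2$ not necessarily connected). Suppose that either $k_1$ is odd and $\frac{k_1^2-k_1}{2}\geq k_2$, or $k_1$ is even and $\frac{k_1^2}{2}>k_2$. Then the Cartesian product $G_1\times G_2$ is antimagic.
   Context: All graphs are finite, undirected and simple. An antimagic labeling of a graph with $m$ edges and $n$ vertices is a bijection from the edge set to $\{1,\ldots,m\}$ such that the $n$ vertex sums are pairwise distinct, where the vertex sum at $v$ is the sum of the labels of all edges incident with $v$. A graph is antimagic if it has an antimagic labeling. The Cartesian product $G_1\times G_2$ of $G_1=(V_1,E_1)$ and $G_2=(V_2,E_2)$ has vertex set $V_1\times V_2$, with $(u_1,u_2)$ adjacent to $(v_1,v_2)$ iff either $u_1=v_1$ and $u_2v_2\in E_2$, or $u_2=v_2$ and $u_1v_1\in E_1$. *)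

(* Defs.v *)
From mathcomp Require Import all_boot.

Set Implicit Arguments.
Unset Strict Implicit.
Unset Printing Implicit Defensive.

Record sgraph := SGraph {
  vertex :> finType;
  adj : rel vertex;
  adj_sym : symmetric adj;
  adj_irrefl : irreflexive adj
}.

Definition degree (G : sgraph) (v : G) : nat := #|[set w | adj v w]|.

(* These bounds hold vacuously on the graph with no vertices. *)
Definition regular (G : sgraph) (k : nat) : Prop :=
  forall v : G, degree v = k.
Definition max_degree_le (G : sgraph) (k : nat) : Prop :=
  forall v : G, degree v <= k.
Definition min_degree_ge (G : sgraph) (k : nat) : Prop :=
  forall v : G, k <= degree v.

(* An edge is the unordered pair [set u; v] of its two endpoints. *)
Definition edges (G : sgraph) : {set {set G}} :=
  [set e : {set G} | [exists u : G, exists v : G, adj u v && (e == [set u; v])]].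

Definition vertex_sum (G : sgraph) (f : {set G} -> nat) (v : G) : nat :=
  \sum_(e in edges G | v \in e) f e.

(* Values of f outside [edges G] play no role: f restricts to a bijection
   from the edge set onto {1, ..., m}, where m is the number of edges. *)
Definition antimagic_labeling (G : sgraph) (f : {set G} -> nat) : Prop :=
  [/\ {in edges G &, injective f},
      forall k : nat,
        (1 <= k <= #|edges G|) <-> (exists2 e, e \in edges G & f e = k)
    & injective (vertex_sum f)].

Definition antimagic (G : sgraph) : Prop :=
  exists f : {set G} -> nat, antimagic_labeling f.

Section CartesianProduct.
Variables G1 G2 : sgraph.

Definition cart_adj : rel (G1 * G2)%type := fun u v =>
  ((u.1 == v.1) && adj u.2 v.2) || ((u.2 == v.2) && adj u.1 v.1).

Lemma cart_adj_sym : symmetric cart_adj.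
Proof.
by move=> u v; rewrite /cart_adj ![v.1 == _]eq_sym ![v.2 == _]eq_sym
  ![adj v.1 _]adj_sym ![adj v.2 _]adj_sym.
Qed.

Lemma cart_adj_irrefl : irreflexive cart_adj.
Proof. by move=> u; rewrite /cart_adj !adj_irrefl !andbF. Qed.

Definition cart_prod : sgraph := SGraph cart_adj_sym cart_adj_irrefl.

End CartesianProduct.

(* Main.v *)
Require Import Defs.
From mathcomp Require Import all_boot.
From mathcomp Require Import zify.

(* Label the G2-type edges with the small labels and the G1-type edges with the
   large ones: with n = #|G1|, the copy of the j-th edge of G2 above u gets
   1 + n j + r1 u, and the copy of an edge e of G1 above v gets
   n #|edges G2| + #|edges G1| (r2 v) + L1 e, for a labeling L1 of G1.  The rank
   r1 sorts the vertices of G1 by their weight under L1, so sums increase with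
   r1 u inside the copy of G1 above v; the rank r2 sorts the vertices of G2, and
   sums of different copies are separated as soon as the weights under L1 are
   close enough to each other.

   A labeling L1 with almost constant weights comes from an orientation of G1.
   Pair up the arcs leaving each vertex, and the arcs entering it, as far as
   possible.  The two pairings decompose the arcs into closed trails of even
   length, alternating forward and backward arcs of G1, so low and high labels
   can alternate with all pair sums in a window of width 3.  For k1 odd, every
   vertex has exactly one unpaired arc, whatever the orientation.  For
   k1 = 2 h, take an Eulerian orientation: if h is even no arc is unpaired, and
   if h is odd remove a perfect matching from tails to heads, that is a
   permutation, and label it separately so that its contributions differ by
   less than n. *)

Set Implicit Arguments.
Unset Strict Implicit.
Unset Printing Implicit Defensive.

(** * Labelings adapted to two pairings *)

(* The orbits of [b \o a] through [t] and [a t] are distinct, and both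
   involutions exchange them. *)
Lemma common_transversal (T : finType) (a b : T -> T) :
  involutive a -> involutive b -> (forall t, a t != t) -> (forall t, b t != t) ->
  exists O : {set T}, forall t, (a t \in O) = (t \notin O) /\ (b t \in O) = (t \notin O).
Proof.
move=> aK bK aN bN; pose f t := b (a t).
have f_inj : injective f by move=> s t /(inv_inj bK)/(inv_inj aK).
have iter_inj i : injective (iter i f) by elim: i => // i IH s t /f_inj/IH.
have symf := fconnect_sym f_inj.
(* [a] conjugates [f] to its inverse. *)
have aiter i t : iter i f (a (iter i f t)) = a t.
  by elim: i => // i IH; rewrite iterSr iterS {2}/f aK /f bK.
(* If [a t] were an iterate of [t] under [f], then halfway along, at [s = iter i f t], either
   [a s = s] or [b (a s) = a s]. *)
have root_neq t : froot f (a t) != froot f t.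
  apply/negP; rewrite eq_sym root_connect // => /iter_findex.
  move: (findex _ _ _) => j jE.
  have [i [jiE|jiE]] : exists i, j = i + i \/ j = i.+1 + i.
    by exists j./2; lia.
  - have := aiter i t; rewrite -jE jiE iterD.
    move/iter_inj; apply/eqP; exact: aN.
  - have := aiter i t; rewrite -jE jiE addSnnS iterD iterS => /iter_inj E.
    by have := bN (a (iter i f t)); rewrite {2}E eqxx.
have rootab t : froot f (b t) = froot f (a t).
  by apply/esym/(rootP symf); apply/(@connect1 _ (frel f))/eqP; rewrite /f aK.
have rootba t : froot f (a (b t)) = froot f t.
  by apply/(rootP symf); apply/(@connect1 _ (frel f))/eqP; rewrite /f aK bK.
exists [set t | enum_rank (froot f t) < enum_rank (froot f (a t))].
move=> t; rewrite !inE aK rootab rootba; split; rewrite -leqNgt ltn_neqAle.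
all: by rewrite (inj_eq val_inj) (inj_eq enum_rank_inj) root_neq.
Qed.

(** [a] exchanges the points of [X] that precede their image in the enumeration of [T] with those
    that follow it. *)
Lemma involution_even (T : finType) (a : T -> T) (X : {set T}) :
  {in X, forall t, a t \in X} -> {in X, cancel a a} -> {in X, forall t, a t != t} ->
  ~~ odd #|X|.
Proof.
move=> aX aK aN; pose r (t : T) := enum_rank t : nat.
have rN t : t \in X -> r (a t) != r t.
  by move=> tX; rewrite (inj_eq val_inj) (inj_eq enum_rank_inj) aN.
rewrite -(cardsID [set t | r t < r (a t)]).
suff -> : X :\: [set t | r t < r (a t)] = a @: (X :&: [set t | r t < r (a t)]).
  rewrite card_in_imset ?addnn ?odd_double // => s t.
  by rewrite !inE => /andP[sX _] /andP[tX _] /(congr1 a); rewrite !aK.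
apply/setP => t; rewrite !inE; apply/idP/imsetP => [/andP[tN tX]|[s]].
  exists (a t); rewrite ?aK // !inE aX //= aK //.
  by have := rN _ tX; lia.
by rewrite !inE => /andP[sX s_lt] ->; rewrite aX // aK // -leqNgt ltnW.
Qed.

(* The closed walk 0, 1, ..., c-1, c-1, ..., 1, 0 of length 2c; its even and its
   odd positions both enumerate [0, c). *)
Definition zigzag c j := minn j (c.*2.-1 - j).

(** The cycles of [f] in [A] are peeled off one at a time, each receiving a block of consecutive
    numbers. On a cycle, the [i]-th point takes for [x] and [y] the entries 2i and 2i+1 of the
    zigzag walk; going from [x t] to [y t] and on to [x (f t)] is then a walk along consecutive
    entries, which differ by at most 1, also where the cycle closes. *)
Lemma cyclic_numbering (T : finType) (f : T -> T) (A : {set T}) :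
  injective f -> (forall t, t \in A -> f t \in A) ->
  exists x y : T -> nat,
    [/\ {in A &, injective x}, {in A &, injective y},
        forall t, t \in A -> x t < #|A| /\ y t < #|A| &
        forall t, t \in A -> [/\ x t <= (y t).+1, y t <= (x t).+1,
          x (f t) <= (y t).+1 & y t <= (x (f t)).+1]].
Proof.
move=> f_inj; have [N] := ubnP #|A|; elim: N A => // N IH A AN fA.
have [->|/set0Pn [t0 t0A]] := eqVneq A set0.
  by exists (fun=> 0), (fun=> 0); split=> t; rewrite inE.
have iterA i : iter i f t0 \in A by elim: i => //= i; apply: fA.
pose B := A :\: [set t | fconnect f t0 t].
have symf := fconnect_sym f_inj.
have fcf t : fconnect f t0 (f t) = fconnect f t0 t.
  by rewrite -(same_fconnect1_r f_inj).
have [||x [y [xi yi xy_lt xy_le]]] := IH B.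
- rewrite -ltnS; apply: leq_trans AN; rewrite ltnS; apply: proper_card.
  by apply/properP; split; [exact: subsetDl | exists t0; rewrite // !inE connect0].
- by move=> t; rewrite !inE fcf => /andP[-> /fA].
pose c := order f t0.
have c_gt0 : 0 < c by exact: order_gt0.
have BA : #|B| + c = #|A|.
  rewrite /c /order cardsD -[X in _ + X](_ : #|A :&: [set t | fconnect f t0 t]| = _).
    by rewrite subnK // subset_leq_card // subsetIl.
  apply: eq_card => t; rewrite !inE andb_idl // => /iter_findex <-; exact: iterA.
pose i t := findex f t0 t.
have i_lt t : fconnect f t0 t -> i t < c by exact: findex_max.
have i_f t : fconnect f t0 t -> i (f t) = if (i t).+1 == c then 0 else (i t).+1.
  move=> ct; case: eqP => [E|NE].
    rewrite -[t in f t](iter_findex ct) -iterS -/(i t) E iter_order // .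
    exact: findex0.
  rewrite -[t in f t](iter_findex ct) -iterS {1}/i findex_iter //.
  by have := i_lt t ct; rewrite -/(i t) -/c; lia.
have i_inj s t : fconnect f t0 s -> fconnect f t0 t -> i s = i t -> s = t.
  by move=> /iter_findex {2}<- /iter_findex {2}<- /= ; rewrite /i => ->.
pose ext (z : T -> nat) (o : nat) t :=
  if fconnect f t0 t then #|B| + zigzag c ((i t).*2 + o) else z t.
have ext_inj z o : o <= 1 -> {in B &, injective z} -> (forall t, t \in B -> z t < #|B|) ->
    {in A &, injective (ext z o)}.
  move=> o1 zi zB s t sA tA; rewrite /ext.
  case: ifP => cs; case: ifP => ct.
  - move=> E; apply: i_inj => //; have := i_lt _ cs; have := i_lt _ ct.
    by move: E; rewrite /zigzag; lia.
  - by have /zB : t \in B; [rewrite !inE ct tA | lia].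
  - by have /zB : s \in B; [rewrite !inE cs sA | lia].
  - by apply: zi; rewrite !inE ?cs ?ct.
exists (ext x 0), (ext y 1); split.
- by apply: ext_inj => // t /xy_lt[].
- by apply: ext_inj => // t /xy_lt[].
- move=> t tA; rewrite /ext -BA; case: ifP => ct.
    by have := i_lt _ ct; rewrite /zigzag; lia.
  by have /xy_lt : t \in B; [rewrite !inE ct tA | lia].
- move=> t tA; rewrite /ext fcf; case: ifP => ct.
    rewrite i_f //; have := i_lt _ ct; rewrite /zigzag.
    by case: eqP => E lt_c; split; lia.
  by apply: xy_le; rewrite !inE ct tA.
Qed.

(* On a transversal [O] the labels are 1 + x, and the partner [a t] of [t] in [O]
   gets the complement #|T| - y t, so each pair sum is #|T| + 1 + x - y. *)
Lemma alternating_labeling (T : finType) (a b : T -> T) :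
  involutive a -> involutive b -> (forall t, a t != t) -> (forall t, b t != t) ->
  exists l : T -> nat,
    [/\ injective l, forall t, 0 < l t <= #|T|,
        forall t, #|T| <= l t + l (a t) <= #|T|.+2 &
        forall t, #|T| <= l t + l (b t) <= #|T|.+2].
Proof.
move=> aK bK aN bN; have [O OP] := common_transversal aK bK aN bN.
have aO t : (a t \in O) = (t \notin O) by case: (OP t).
have bO t : (b t \in O) = (t \notin O) by case: (OP t).
have cardT : #|T| = #|O|.*2.
  rewrite -cardsT -(setUCr O) cardsU setICr cards0 subn0.
  rewrite -addnn; congr (_ + _); rewrite -(card_imset (mem O) (inv_inj aK)).
  apply: eq_card => t; rewrite !inE; apply/idP/imsetP => [tO|[s]].
    by exists (a t); rewrite ?aK // aO.
  by move=> sO ->; rewrite aO negbK.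
have [||x [y [xi yi xy_lt xy_le]]] := @cyclic_numbering T (fun t => b (a t)) O.
- by move=> s t /(inv_inj bK)/(inv_inj aK).
- by move=> t tO; rewrite bO aO negbK.
rewrite cardT; exists (fun t => if t \in O then (x t).+1 else #|O|.*2 - y (a t)); split.
- move=> s t; case: ifP => sO; case: ifP => tO.
  + by move=> [] /xi; apply.
  + by have /xy_lt : a t \in O; [rewrite aO tO | have := xy_lt _ sO; lia].
  + by have /xy_lt : a s \in O; [rewrite aO sO | have := xy_lt _ tO; lia].
  + have asO : a s \in O by rewrite aO sO.
    have atO : a t \in O by rewrite aO tO.
    have := xy_lt _ asO; have := xy_lt _ atO => ? ? ?.
    by apply/(inv_inj aK)/yi => //; lia.
- move=> t; case: ifP => tO; first by have := xy_lt _ tO; lia.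
  by have /xy_lt : a t \in O; [rewrite aO tO | lia].
- move=> t; rewrite aO aK; case: ifP => tO /=.
    by have := xy_lt _ tO; case: (xy_le _ tO); lia.
  have atO : a t \in O by rewrite aO tO.
  by have := xy_lt _ atO; case: (xy_le _ atO); rewrite aK; lia.
(* The point [a (b t)] is the preimage of [t] under [b \o a], so for [t] in [O] this sum compares
   [y] at that preimage with [x] at its image. *)
- move=> t; rewrite bO; case: ifP => tO /=.
    have abO : a (b t) \in O by rewrite aO bO tO.
    have [] := xy_le _ abO; rewrite aK bK.
    by have := xy_lt _ abO; have := xy_lt _ tO; lia.
  have atO : a t \in O by rewrite aO tO.
  have btO : b t \in O by rewrite bO tO.
  have [] := xy_le _ atO; rewrite aK.
  by have := xy_lt _ atO; have := xy_lt _ btO; lia.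
Qed.

(** * Pairings inside the fibres of a map *)

(** Pairs inside a fibre are split off as long as there are any. Then [g] is injective on what is
    left, which is paired arbitrarily, so each fibre has at most one point whose partner lies
    outside. *)
Lemma set_pairing_in_fibres (T : finType) (V : eqType) (g : T -> V) (A : {set T}) :
  ~~ odd #|A| -> exists a : T -> T,
    [/\ {in A, forall t, a t \in A}, {in A, cancel a a}, {in A, forall t, a t != t} &
        {in A &, forall s t, g s = g t -> g (a s) != g s -> g (a t) != g t -> s = t}].
Proof.
have [N] := ubnP #|A|; elim: N A => // N IH A AN Aeven.
(* Both kinds of removal at once: [u] and [v] share a fibre, or [g] is already injective on [A] and
   the last condition is trivial. *)
have step u v : u \in A -> v \in A -> u != v ->
    (g u != g v -> {in A &, injective g}) -> exists a : T -> T,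
    [/\ {in A, forall t, a t \in A}, {in A, cancel a a}, {in A, forall t, a t != t} &
        {in A &, forall s t, g s = g t -> g (a s) != g s -> g (a t) != g t -> s = t}].
  move=> uA vA uv g_inj.
  have vAu : v \in A :\ u by rewrite !inE eq_sym uv.
  have cA := cardsD1 u A; have cAu := cardsD1 v (A :\ u).
  rewrite uA in cA; rewrite vAu in cAu.
  have [||a [aA aK aN ag]] := IH (A :\ u :\ v); try by move: AN Aeven; lia.
  have inA t : t != u -> t != v -> t \in A -> t \in A :\ u :\ v.
    by move=> tu tv tA; rewrite !inE tu tv.
  have aAN t : t != u -> t != v -> t \in A -> [/\ a t != u, a t != v & a t \in A].
    by move=> tu tv tA; have := aA _ (inA _ tu tv tA); rewrite !inE => /and3P[-> -> ->].
  exists (fun t => if t == u then v else if t == v then u else a t); split.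
  - move=> t tA; case: eqP => // /eqP tu; case: eqP => // /eqP tv.
    by case: (aAN t).
  - move=> t tA /=; have [->|tu] := eqVneq t u; first by rewrite eq_sym (negPf uv) eqxx.
    have [->|tv] := eqVneq t v; first by rewrite eqxx.
    have [au av _] := aAN t tu tv tA; rewrite (negPf au) (negPf av).
    by apply: aK; apply: inA.
  - move=> t tA; have [->|tu] := eqVneq t u; first by rewrite eq_sym.
    have [->|tv] := eqVneq t v; first by [].
    by apply: aN; apply: inA.
  - move=> s t sA tA gst; have [guv|/g_inj gA _ _] := eqVneq (g u) (g v); last exact: gA.
    have [->|su] := eqVneq s u; first by rewrite guv eqxx.
    have [->|sv] := eqVneq s v; first by rewrite guv eqxx.
    have [->|tu] := eqVneq t u; first by rewrite guv eqxx.
    have [->|tv] := eqVneq t v; first by rewrite guv eqxx.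
    by apply: ag; rewrite ?inA.
have [|Agt1] := leqP #|A| 1.
  case E : #|A| Aeven => [|[|//]] // _ _; exists id.
  by move/eqP: E; rewrite cards_eq0 => /eqP->; split=> [t|t|t|s t]; rewrite inE.
have [/existsP[u /existsP[v /and4P[uA vA uv guv]]]|] :=
  boolP [exists u, exists v, [&& u \in A, v \in A, u != v & g u == g v]].
  by apply: (step u v) => //; rewrite guv.
move=> /existsPn noP; have [u [v [uA vA uv]]] := card_gt1P Agt1.
apply: (step u v) => // _ s t sA tA gst; apply/eqP; apply/negP => /negP st.
by have /existsPn /(_ t) := noP s; rewrite sA tA st gst eqxx.
Qed.

Lemma pairing_in_fibres (T : finType) (V : eqType) (g : T -> V) :
  ~~ odd #|T| -> exists a : T -> T,
    [/\ involutive a, forall t, a t != t &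
        forall s t, g s = g t -> g (a s) != g s -> g (a t) != g t -> s = t].
Proof.
rewrite -cardsT => /(set_pairing_in_fibres g)[a [_ aK aN ag]].
by exists a; split=> [t|t|s t]; [apply: aK | apply: aN | apply: ag]; rewrite inE.
Qed.

(* The fixed points of [a] are the points left unpaired, at most one per fibre. *)
Definition fibrewise_balanced (T : finType) (V : eqType) (l : T -> nat) (C : nat)
    (g : T -> V) :=
  exists a : T -> T,
    [/\ involutive a, forall t, g (a t) = g t,
        forall s t, g s = g t -> a s = s -> a t = t -> s = t &
        forall t, a t != t -> C <= l t + l (a t) <= C + 3].

(** Pairs that straddle two fibres are dissolved into fixed points. *)
Lemma balanced_even (T : finType) (V : eqType) (l : T -> nat) C (g : T -> V) a :
  involutive a -> (forall t, a t != t) ->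
  (forall s t, g s = g t -> g (a s) != g s -> g (a t) != g t -> s = t) ->
  (forall t, C <= l t + l (a t) <= C + 3) -> fibrewise_balanced l C g.
Proof.
move=> aK aN ag lC; exists (fun t => if g (a t) == g t then a t else t); split.
- move=> t; have [E|/negPf E] := boolP (g (a t) == g t); last by rewrite E.
  by rewrite aK eq_sym E.
- by move=> t; case: ifP => [/eqP|].
- move=> s t gst; case: ifP => [_ /eqP|/negbT gs _]; first by rewrite (negPf (aN s)).
  by case: ifP => [_ /eqP|/negbT gt _]; [rewrite (negPf (aN t)) | apply: ag].
- by move=> t; case: ifP; rewrite ?eqxx.
Qed.

(* Adding a dummy point [None] makes the cardinal even; its label is then removed
   and the larger labels are shifted down. *)
Lemma balanced_odd (T : finType) (V : eqType) (l : option T -> nat) C (g : T -> V) a :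
  involutive a -> (forall t, a t != t) ->
  (forall s t, omap g s = omap g t -> omap g (a s) != omap g s ->
     omap g (a t) != omap g t -> s = t) ->
  (forall s t, a (Some s) = Some t -> C <=
     (l (Some s) - (l None < l (Some s))) + (l (Some t) - (l None < l (Some t))) <= C + 3) ->
  fibrewise_balanced (fun t => l (Some t) - (l None < l (Some t))) C g.
Proof.
move=> aK aN ag lC.
pose b t := if a (Some t) is Some s then if g s == g t then s else t else t.
have bE t : (exists2 s, a (Some t) = Some s & g s = g t /\ b t = s) \/
            (omap g (a (Some t)) != omap g (Some t) /\ b t = t).
  rewrite /b; case E : (a (Some t)) => [s|] /=; last by right.
  case: eqP => [gst|/eqP gst]; first by left; exists s.
  by right; split=> //; apply: contra gst => /eqP[->].
exists b; split.
- move=> t; have [[s as_ [gs bt]]|[_ bt]] := bE t; rewrite !bt //.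
  by rewrite /b -as_ aK -gs eqxx.
- by move=> t; have [[s _ [gs ->]]|[_ ->]] := bE t.
- move=> s t gst; case: (bE s) => [[s' as_ [_ ->]] E|[gs _] _].
    by have := aN (Some s); rewrite as_ E eqxx.
  case: (bE t) => [[t' at_ [_ ->]] E|[gt _] _].
    by have := aN (Some t); rewrite at_ E eqxx.
  by have [] : Some s = Some t by apply: ag => //=; rewrite gst.
- move=> t; case: (bE t) => [[s as_ [_ ->]] _|[_ ->]]; last by rewrite eqxx.
  exact: lC.
Qed.

Lemma balanced_labeling (T : finType) (V : eqType) (g1 g2 : T -> V) :
  exists (l : T -> nat) (C : nat),
    [/\ injective l, forall t, 0 < l t <= #|T|,
        fibrewise_balanced l C g1 & fibrewise_balanced l C g2].
Proof.
have [Todd|Teven] := boolP (odd #|T|); last first.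
  have [a [aK aN ag]] := pairing_in_fibres g1 Teven.
  have [b [bK bN bg]] := pairing_in_fibres g2 Teven.
  have [l [l_inj l_bd la lb]] := alternating_labeling aK bK aN bN.
  exists l, #|T|; split=> //; [apply: (balanced_even aK aN ag)|apply: (balanced_even bK bN bg)].
  - by move=> t; have := la t; lia.
  - by move=> t; have := lb t; lia.
have Oeven : ~~ odd #|{: option T}| by rewrite card_option /= negbK.
have [a [aK aN ag]] := pairing_in_fibres (omap g1) Oeven.
have [b [bK bN bg]] := pairing_in_fibres (omap g2) Oeven.
have [l [l_inj l_bd la lb]] := alternating_labeling aK bK aN bN.
rewrite card_option in l_bd la lb.
have lN s : l (Some s) <> l None by move/l_inj.
(* Write [n] for [#|T|]. Before the shift, pair sums lie between [n + 1] and [n + 3]. If [l None] is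
   at most [(n + 1) / 2], the larger label of each pair exceeds it, so the sum drops by 1 or 2;
   otherwise the two labels cannot both exceed it, and the sum drops by 0 or 1. Either way four
   consecutive values remain, starting at [n - 1] or at [n]. *)
pose C := #|T| - (l None <= uphalf #|T|).
exists (fun t => l (Some t) - (l None < l (Some t))), C.
have main c : involutive c -> (forall t, c t != t) ->
    (forall t, #|T|.+1 <= l t + l (c t) <= #|T|.+3) ->
    forall s t, c (Some s) = Some t -> C <=
     (l (Some s) - (l None < l (Some s))) + (l (Some t) - (l None < l (Some t))) <= C + 3.
  move=> cK cN lc s t cs; have := lc (Some s); rewrite cs.
  have st : l (Some s) <> l (Some t).
    by move/l_inj => E; have := cN (Some s); rewrite cs E eqxx.
  have := lN s; have := lN t; rewrite /C.
  by move: (l None) (l (Some s)) (l (Some t)) st #|T| Todd; lia.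
split.
- move=> s t E; have := lN s; have := lN t => ? ?.
  by have [] : Some s = Some t by apply: l_inj; lia.
- move=> t; have := l_bd (Some t); have := l_bd None; have := lN t; lia.
- exact: balanced_odd aK aN ag (main a aK aN la).
- exact: balanced_odd bK bN bg (main b bK bN lb).
Qed.

(** Over the paired points of the fibre, twice the sum of [l t] is the sum of [l t + l (a t)], whose
    terms lie in the window. An unpaired point exists exactly when [F] is odd, and its label is only
    known to lie between 1 and [N]. *)
Lemma balanced_fibre_sum (T : finType) (V : eqType) (l : T -> nat) N C (g : T -> V) v F :
  (forall t, 0 < l t <= N) -> fibrewise_balanced l C g ->
  #|[set t | g t == v]| = F ->
  (F - odd F) * C + odd F * 2 <= 2 * \sum_(t | g t == v) l t
    <= (F - odd F) * (C + 3) + odd F * (2 * N).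
Proof.
move=> lN [a [aK ga a_fix lC]] Fv.
pose X := [set t | (g t == v) && (a t != t)].
pose Y := [set t | (g t == v) && (a t == t)].
have cF : F = #|X| + #|Y|.
  rewrite -Fv -(cardsID [set t | a t == t]) addnC; congr (_ + _); apply: eq_card => t.
    by rewrite !inE andbC.
  by rewrite !inE.
have Xeven : ~~ odd #|X|.
  apply: (@involution_even _ a) => t; rewrite inE => /andP[gt at_] //.
    by rewrite inE ga gt aK eq_sym.
have Y1 : #|Y| <= 1.
  apply/card_le1P => s; rewrite inE => /andP[/eqP gs /eqP as_] t.
  rewrite !inE; apply/andP/eqP => [[/eqP gt /eqP at_]|->]; last by rewrite gs as_ !eqxx.
  by apply: a_fix; rewrite ?gs.
have oddF : odd F = #|Y| :> nat by move: Xeven Y1; rewrite cF; lia.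
have -> : F - odd F = #|X| by lia.
rewrite oddF.
have -> : \sum_(t | g t == v) l t = \sum_(t in X) l t + \sum_(t in Y) l t.
  rewrite addnC (bigID (fun t => a t == t)) /=.
  by congr (_ + _); apply: eq_bigl => t; rewrite inE.
have -> : 2 * (\sum_(t in X) l t + \sum_(t in Y) l t) =
          \sum_(t in X) (l t + l (a t)) + 2 * \sum_(t in Y) l t.
  rewrite big_split /= [X in _ = _ + X + _](_ : _ = \sum_(t in X) l t); first by lia.
  rewrite [RHS](reindex_inj (inv_inj aK)) /=; apply: eq_bigl => t.
  by rewrite !inE ga aK [t == _]eq_sym.
have X_le : #|X| * C <= \sum_(t in X) (l t + l (a t)) <= #|X| * (C + 3).
  rewrite -!sum_nat_const; apply/andP; split; apply: leq_sum => t;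
    by rewrite inE => /andP[_ /lC/andP[]].
have Y_le : #|Y| * 1 <= \sum_(t in Y) l t <= #|Y| * N.
  rewrite -!sum_nat_const; apply/andP; split; apply: leq_sum => t _;
    by have /andP[] := lN t.
by move: X_le Y_le; lia.
Qed.

(** * Matchings and permutations *)

(* Rado's argument: as long as some [N x] has two elements, submodularity of
   [#|\bigcup_(x in X) N x|] lets one of them be deleted. *)
Lemma hall (V W : finType) (N : V -> {set W}) :
  (forall X : {set V}, #|X| <= #|\bigcup_(x in X) N x|) ->
  exists2 s : V -> W, injective s & forall x, s x \in N x.
Proof.
have [k] := ubnP (\sum_x #|N x|); elim: k N => // k IH N Nk hN.
have [/existsP[x /card_gt1P[a [b [aN bN ab]]]]|/existsPn N1] :=
  boolP [exists x, 1 < #|N x|]; last first.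
  have N1' x : #|N x| = 1.
    by have := N1 x; have := hN [set x]; rewrite big_set1 cards1; lia.
  have sP x : {w | N x == [set w]}.
    by apply: sigW; have /eqP/cards1P[w ->] := N1' x; exists w.
  exists (fun x => sval (sP x)) => [x y|x]; last by case: (sP x) => w /= /eqP->; rewrite set11.
  case: (sP x) (sP y) => [w /= /eqP Nx] [w' /= /eqP Ny] ww; apply/eqP; apply/negPn/negP => xy.
  have := hN [set x; y]; rewrite cards2 xy bigcup_setU !big_set1 Nx Ny ww setUid.
  by rewrite cards1.
pose M c y := if y == x then N x :\ c else N y.
have M_lt c : c \in N x -> \sum_y #|M c y| < k.
  move=> cN; rewrite -ltnS; apply: leq_trans Nk; rewrite ltnS.
  rewrite (bigD1 x) //= [in X in _ < X](bigD1 x) //= /M eqxx.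
  rewrite (cardsD1 c (N x)) cN -addSn add1n leq_add2l //.
  by apply/eq_leq/eq_bigr => y /negPf->.
have M_sub c s : injective s -> (forall y, s y \in M c y) ->
    exists2 s : V -> W, injective s & forall x, s x \in N x.
  move=> s_inj sM; exists s => // y; have := sM y; rewrite /M.
  by case: eqP => // ->; rewrite inE => /andP[].
have [/forallP hM|/forallPn[X hX]] :=
  boolP [forall X : {set V}, #|X| <= #|\bigcup_(x in X) M a x|].
  by have [s s_inj sM] := IH _ (M_lt a aN) hM; apply: M_sub sM.
have [/forallP hM|/forallPn[Y hY]] :=
  boolP [forall X : {set V}, #|X| <= #|\bigcup_(x in X) M b x|].
  by have [s s_inj sM] := IH _ (M_lt b bN) hM; apply: M_sub sM.
(* A violating set for [M c] must contain [x], since [N] itself satisfies Hall's condition; the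
   conclusion is the violation with [x] taken out of the set. *)
have viol c (Z : {set V}) : ~~ (#|Z| <= #|\bigcup_(y in Z) M c y|) ->
    #|(\bigcup_(y in Z :\ x) N y) :|: N x :\ c| <= #|Z :\ x|.
  have Mx : \bigcup_(y in Z :\ x) M c y = \bigcup_(y in Z :\ x) N y.
    by apply: eq_bigr => y; rewrite /M !inE => /andP[/negPf->].
  have [xZ|xZ] := boolP (x \in Z).
    rewrite (cardsD1 x Z) xZ (big_setD1 x xZ) /= Mx {1}/M eqxx setUC; lia.
  have -> : Z :\ x = Z by apply/setP => y; rewrite !inE andb_idl // => yZ;
    apply: contraNneq xZ => <-.
  rewrite -ltnNge => lt; have := hN Z; move: lt.
  suff -> : \bigcup_(y in Z) M c y = \bigcup_(y in Z) N y by lia.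
  by apply: eq_bigr => y yZ; rewrite /M; case: eqP => // yx; rewrite -yx yZ in xZ.
have {hX} := viol _ _ hX; have {hY} := viol _ _ hY.
set X' := X :\ x; set Y' := Y :\ x; set A := _ :|: _; set B := _ :|: _ => hA hB.
have := cardsUI A B; have := cardsUI X' Y'.
(* As [a] and [b] differ, [A :|: B] contains all of [N x]. Hall's condition for [x |: (X' :|: Y')]
   and for [X' :&: Y'] then makes [#|A| + #|B|] exceed [#|X'| + #|Y'|], against [hA] and [hB]. *)
have := hN (x |: (X' :|: Y')); rewrite cardsU1 !inE !eqxx /= => hU.
have := hN (X' :&: Y') => hI.
have : #|\bigcup_(y in x |: (X' :|: Y')) N y| <= #|A :|: B|.
  apply: subset_leq_card; apply/bigcupsP => y; rewrite !inE => /orP[/eqP->|yXY].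
    apply/subsetP => w wN; rewrite !inE wN !andbT.
    by case: (eqVneq w a) => [->|]; rewrite ?ab ?orbT.
  apply/subsetP => w wN; rewrite in_setU; apply/orP.
  by case/orP: yXY => /andP[yx yZ]; [right|left]; rewrite inE; apply/orP; left;
    apply/bigcupP; exists y; rewrite // !inE yx.
have : #|\bigcup_(y in X' :&: Y') N y| <= #|A :&: B|.
  apply: subset_leq_card; apply/bigcupsP => y; rewrite in_setI => /andP[yX yY].
  by apply/subsetP => w wN; rewrite in_setI !in_setU; apply/andP; split;
    apply/orP; left; apply/bigcupP; exists y.
lia.
Qed.

(** Hall's condition by double counting: [h * #|X|] arcs leave [X], and each vertex they reach
    receives at most [h] of them. *)
Lemma regular_matching (V : finType) (R : rel V) h : 0 < h ->
  (forall v, #|[set w | R v w]| = h) -> (forall w, #|[set v | R v w]| = h) ->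
  exists2 s : V -> V, injective s & forall v, R v (s v).
Proof.
move=> h_gt0 outR inR; have [|s s_inj sR] := @hall V V (fun v => [set w | R v w]).
  move=> X; rewrite -(leq_pmul2r h_gt0) -!sum_nat_const.
  set Y := \bigcup_(x in X) _.
  have -> : \sum_(x in X) h = \sum_(x in X) \sum_(w | R x w) 1.
    by apply: eq_bigr => x _; rewrite sum1dep_card outR.
  rewrite (exchange_big_dep (mem Y)) /= => [|x w xX xw]; last first.
    by apply/bigcupP; exists x; rewrite ?inE.
  apply: leq_sum => w _; rewrite -(inR w) sum1dep_card subset_leq_card //.
  by apply/subsetP => x; rewrite !inE => /andP[].
by exists s => // v; have := sR v; rewrite inE.
Qed.

(* [H] is a maximal set disjoint from its image; [H] and [f @: H] receive the
   top and the bottom labels, complementary along [f], and the remaining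
   points, which [f] maps into [H], the labels in between. *)
Lemma permutation_labeling (V : finType) (f : V -> V) :
  injective f -> (forall v, f v != v) ->
  exists (x : V -> nat) (C : nat),
    [/\ injective x, forall v, 0 < x v <= #|V| &
        forall v, C <= x v + x (f v) < C + #|V|].
Proof.
move=> f_inj fN; pose P (H : {set V}) := [forall t in H, f t \notin H].
have P0 : P set0 by apply/forall_inP => t; rewrite inE.
case: (arg_maxnP (fun H : {set V} => #|H|) P0) => H /forall_inP HP Hmax.
pose g := finv f; have gK v : g (f v) = v by apply: finv_f.
have fK v : f (g v) = v by apply: f_finv.
pose E := [set v | (v \notin H) && (g v \notin H)].
have fE v : v \in E -> f v \in H.
  rewrite inE => /andP[vH gvH]; apply: contraT => fvH.
  have /Hmax : P (v |: H); last by rewrite cardsU1 vH; lia.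
  apply/forall_inP => t; rewrite !inE negb_or => /orP[/eqP->|tH].
    by rewrite fN fvH.
  by rewrite HP // andbT; apply: contraNneq gvH => <-; rewrite gK.
(* The images of [E] come first in this enumeration of [H], so their ranks are below [#|E|] and also
   serve to number [E]. *)
pose s := [seq f v | v <- enum E] ++ enum (H :\: f @: E).
have s_H v : (v \in s) = (v \in H).
  rewrite mem_cat mem_enum !inE; apply/orP/idP => [[/mapP[e]|/andP[]//]|vH].
    by rewrite mem_enum => /fE ? ->.
  have [/imsetP[e eE ->]|vE] := boolP (v \in f @: E); last by right.
  by left; rewrite map_f // mem_enum.
have s_uniq : uniq s.
  rewrite cat_uniq (map_inj_uniq f_inj) !enum_uniq andbT /=.
  apply/hasPn => v; rewrite mem_enum inE => /andP[vE _].
  by apply: contra vE => /mapP[e eE ->]; rewrite imset_f // -mem_enum.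
have s_size : size s = #|H|.
  by rewrite -(card_uniqP s_uniq); apply: eq_card => v; rewrite s_H.
pose r v := index v s.
have r_lt v : v \in H -> r v < #|H| by rewrite -s_H -s_size index_mem.
have r_inj : {in H &, injective r}.
  move=> u v uH vH ruv; rewrite -(nth_index u (s := s) (x := u)) ?s_H //.
  by rewrite -/(r u) ruv nth_index ?s_H.
have r_E v : v \in E -> r (f v) < #|E|.
  move=> vE; rewrite /r index_cat map_f ?mem_enum // (index_map f_inj).
  by rewrite cardE index_mem mem_enum.
have cV : #|V| = #|H| + #|H| + #|E|.
  rewrite -[X in _ + X + _](card_imset (mem H) f_inj) -(cardsC H) -addnA; congr (_ + _).
  rewrite -(cardsID (f @: H) (~: H)); congr (_ + _); apply: eq_card => v; rewrite !inE.
    rewrite andb_idl // => /imsetP[u /HP uH ->]; exact: uH.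
  rewrite andbC; congr (_ && ~~ _); apply/imsetP/idP => [[u uH ->]|gvH].
    by rewrite gK.
  by exists (g v).
have casesV v : [\/ v \in H, v \notin H /\ g v \in H | [/\ v \notin H, g v \notin H & v \in E]].
  rewrite inE; case: (boolP (v \in H)) => vH; first by apply: Or31.
  by case: (boolP (g v \in H)) => gvH; [apply: Or32 | apply: Or33].
pose x v := if v \in H then #|V| - r v
  else if g v \in H then (r (g v)).+1 else #|H| + (r (f v)).+1.
(* The sum [x v + x (f v)] is [#|V| + 1] on [H] and [#|H| + #|V| + 1] on [E]; on [f @: H] it lies
   between [#|H| + 2] and [#|H| + #|V|]. *)
exists x, (#|H| + 2); split.
- move=> u v; rewrite /x; case: (casesV u) => [uH|[/negPf uH gu]|[/negPf uH /negPf gu uE]];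
  case: (casesV v) => [vH|[/negPf vH gv]|[/negPf vH /negPf gv vE]];
  rewrite ?uH ?vH ?gu ?gv;
  try have := r_lt _ uH; try have := r_lt _ vH; try have := r_lt _ gu; try have := r_lt _ gv;
  try have := r_E _ uE; try have := r_E _ vE; try lia.
  + by move=> ? ? ?; apply: r_inj => //; lia.
  + by move=> ? ? [] /r_inj E'; rewrite -(fK u) E' ?fK.
  + move=> ? ? E'; have : r (f u) = r (f v) by lia.
    by move/r_inj => E''; apply/f_inj/E''; apply: fE.
- move=> v; rewrite /x; case: (casesV v) => [vH|[/negPf vH gv]|[/negPf vH /negPf gv vE]];
  rewrite ?vH ?gv; try have := r_lt _ vH; try have := r_lt _ gv; try have := r_E _ vE; lia.
- move=> v; rewrite /x gK.
  case: (casesV v) => [vH|[/negPf vH gv]|[/negPf vH /negPf gv vE]]; rewrite ?vH ?gv.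
  + by rewrite (negPf (HP _ vH)); have := r_lt _ vH; lia.
  + have := r_lt _ gv; case: (casesV (f v)) => [fv|[_]|[/negPf fv _ fvE]].
    * by rewrite fv; have := r_lt _ fv; lia.
    * by rewrite gK vH.
    * by rewrite fv; have := r_E _ fvE; lia.
  + by rewrite (fE _ vE); have := r_lt _ (fE _ vE); lia.
Qed.

(** This is [balanced_labeling] on the type of arcs, with tail and head as the two maps, read back
    as a function of two vertices. *)
Lemma balanced_arc_labeling (V : finType) (A : rel V) :
  let N := #|[set p : V * V | A p.1 p.2]| in
  exists (l : V -> V -> nat) (C : nat),
  [/\ forall u v u' v', A u v -> A u' v' -> l u v = l u' v' -> (u, v) = (u', v'),
      forall u v, A u v -> 0 < l u v <= N,
      forall v F, #|[set w | A v w]| = F ->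
        (F - odd F) * C + odd F * 2 <= 2 * \sum_(w | A v w) l v w
          <= (F - odd F) * (C + 3) + odd F * (2 * N) &
      forall v F, #|[set w | A w v]| = F ->
        (F - odd F) * C + odd F * 2 <= 2 * \sum_(w | A w v) l w v
          <= (F - odd F) * (C + 3) + odd F * (2 * N)].
Proof.
move=> N; pose T := {p : V * V | A p.1 p.2}.
have [l [C [l_inj l_bd bal1 bal2]]] :=
  balanced_labeling (fun t : T => (val t).1) (fun t : T => (val t).2).
have cT : #|{: T}| = N by rewrite card_sig; apply: eq_card => p; rewrite inE.
rewrite cT in l_bd.
pose L u v := if insub (u, v) is Some t then l (t : T) else 0.
have LE (t : T) : L (val t).1 (val t).2 = l t.
  by rewrite /L -surjective_pairing valK.
have arc u v : A u v -> exists2 t : T, val t = (u, v) & L u v = l t.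
  by move=> Auv; exists (Sub (u, v) Auv); rewrite ?SubK // -LE SubK.
exists L, C; split.
- move=> u v u' v' /arc[t <- ->] /arc[t' <- ->] /l_inj-> //.
- by move=> u v /arc[t _ ->].
- move=> v F Fv.
  have E (G : T -> nat) : \sum_(t : T | (val t).1 == v) G t =
      \sum_(w | A v w) if insub (v, w) is Some t then G (t : T) else 0.
    rewrite [RHS](reindex_omap (fun t : T => (val t).2) (fun w => insub (v, w))) /=.
      apply: eq_big => t; last by move=> /eqP <-; rewrite -surjective_pairing valK.
      apply/eqP/andP => [<-|[Av /eqP]].
        by rewrite -surjective_pairing valK (valP t).
      by rewrite insubT => -[<-].
    by move=> w Avw; rewrite insubT.
  have cF : #|[set t : T | (val t).1 == v]| = F.
    rewrite -Fv -!sum1dep_card E; apply: eq_bigr => w Av; by rewrite insubT.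
  by have := balanced_fibre_sum l_bd bal1 cF; rewrite E.
- move=> v F Fv.
  have E (G : T -> nat) : \sum_(t : T | (val t).2 == v) G t =
      \sum_(w | A w v) if insub (w, v) is Some t then G (t : T) else 0.
    rewrite [RHS](reindex_omap (fun t : T => (val t).1) (fun w => insub (w, v))) /=.
      apply: eq_big => t; last by move=> /eqP <-; rewrite -surjective_pairing valK.
      apply/eqP/andP => [<-|[Av /eqP]].
        by rewrite -surjective_pairing valK (valP t).
      by rewrite insubT => -[<-].
    by move=> w Awv; rewrite insubT.
  have cF : #|[set t : T | (val t).2 == v]| = F.
    rewrite -Fv -!sum1dep_card E; apply: eq_bigr => w Av; by rewrite insubT.
  by have := balanced_fibre_sum l_bd bal2 cF; rewrite E.
Qed.

(** * Orientations and edge labelings *)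

Definition orientation (G : sgraph) (O : rel G) :=
  (forall u v, O u v -> adj u v) /\ (forall u v, adj u v -> O u v = ~~ O v u).

Lemma orientation_exists (G : sgraph) : exists O : rel G, orientation O.
Proof.
exists (fun u v => adj u v && (enum_rank u < enum_rank v)); split=> [u v /andP[]//|u v uv].
rewrite (adj_sym v) uv /= -leqNgt ltn_neqAle (inj_eq val_inj) (inj_eq enum_rank_inj).
by rewrite andb_idl // => _; apply: contraTneq uv => ->; rewrite adj_irrefl.
Qed.

Lemma orientation_sum (G : sgraph) (O : rel G) (F : G -> nat) v : orientation O ->
  \sum_(w | adj v w) F w = \sum_(w | O v w) F w + \sum_(w | O w v) F w.
Proof.
case=> Oadj ON; rewrite (bigID (O v)) /=; congr (_ + _); apply: eq_bigl => w.
  by rewrite andb_idl // => /Oadj.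
apply/andP/idP => [[vw vwN]|wv]; first by rewrite ON // adj_sym.
by have wv' := Oadj _ _ wv; rewrite adj_sym wv' -ON.
Qed.

Lemma orientation_degree (G : sgraph) (O : rel G) (v : G) : orientation O ->
  degree v = #|[set w | O v w]| + #|[set w | O w v]|.
Proof. by move=> Oor; rewrite /degree -!sum1dep_card (orientation_sum _ _ Oor). Qed.

(** Two involutions act on the arcs: [rev] reverses an arc, and [b] pairs the arcs with a common
    tail. A common transversal contains one direction of each edge and half of the arcs leaving each
    vertex. *)
Lemma eulerian_orientation (G : sgraph) h : regular G h.*2 ->
  exists O : rel G, orientation O /\
    forall v, #|[set w | O v w]| = h /\ #|[set w | O w v]| = h.
Proof.
move=> reg; pose T := {p : G * G | adj p.1 p.2}.
have revP (t : T) : adj ((val t).2, (val t).1).1 ((val t).2, (val t).1).2.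
  by rewrite /= adj_sym (valP t).
pose rev t : T := Sub (_, _) (revP t).
have revK : involutive rev by move=> t; apply: val_inj; rewrite !SubK -surjective_pairing.
have revN t : rev t != t.
  apply/eqP => /(congr1 val); rewrite SubK => /(congr1 fst) /= E.
  by have := valP t; rewrite /= E adj_irrefl.
have Teven : ~~ odd #|{: T}|.
  by rewrite -cardsT; apply: (@involution_even _ rev) => t; rewrite ?inE.
pose tl (t : T) := (val t).1.
have [b [bK bN b_tl]] := pairing_in_fibres tl Teven.
have fibre (P : pred G) v : #|[set t : T | (tl t == v) && P (val t).2]| =
    #|[set w | adj v w && P w]|.
  rewrite -(card_in_imset (f := fun t : T => (val t).2)).
    apply: eq_card => w; rewrite inE; apply/imsetP/andP => [[t]|[vw Pw]].
      by rewrite inE => /andP[/eqP<- Pt] ->; split=> //; apply: (valP t).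
    by exists (Sub (v, w) vw : T); rewrite ?inE /tl SubK ?eqxx.
  move=> s t; rewrite !inE /tl => /andP[/eqP sv _] /andP[/eqP tv _] st.
  by apply: val_inj; rewrite [val s]surjective_pairing [val t]surjective_pairing sv tv st.
(* If the partner of [t] had another tail, [t] would be the only such arc in its fibre, and [b]
   would pair up the other [h.*2 - 1] arcs there. *)
have b_fibre t : tl (b t) = tl t.
  apply/eqP; apply: contraT => tN.
  have : ~~ odd #|[set s | tl s == tl t] :\ t|.
    apply: (@involution_even _ b) => s //; rewrite !inE => /andP[st ss].
    apply/andP; split.
      by apply: contraNneq tN => bs; rewrite -bs bK bs.
    apply: contraR st => bs; apply/eqP/b_tl; rewrite ?(eqP ss) //.
  have := cardsD1 t [set s | tl s == tl t]; rewrite inE eqxx.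
  have -> : #|[set s | tl s == tl t]| = h.*2.
    rewrite -(reg (tl t)) /degree; have := fibre predT (tl t).
    have -> : [set w | adj (tl t) w && predT w] = [set w | adj (tl t) w].
      by apply/setP => w; rewrite !inE andbT.
    by move=> <-; apply: eq_card => s; rewrite !inE andbT.
  by lia.
have [Q QP] := common_transversal revK bK revN bN.
pose O u v := if insub (u, v) is Some t then (t : T) \in Q else false.
have OE u v (uv : adj u v) : O u v = ((Sub (u, v) uv : T) \in Q) by rewrite /O insubT.
have Oadj u v : O u v -> adj u v by rewrite /O; case: insubP.
have Oor : orientation O.
  split=> // u v uv; have vu : adj v u by rewrite adj_sym.
  rewrite (OE _ _ uv) (OE _ _ vu) -(QP (Sub (v, u) vu)).1; congr (_ \in Q).
  exact: val_inj.
exists O; split=> // v.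
have outE : #|[set w | O v w]| = h.
  pose X := [set t : T | (tl t == v) && (t \in Q)].
  have cX : #|[set w | O v w]| = #|X|.
    transitivity #|[set w | adj v w && O v w]|.
      by apply: eq_card => w; rewrite !inE andb_idl // => /Oadj.
    rewrite -fibre; apply: eq_card => t; rewrite !inE; case: eqP => //= <-.
    by rewrite /O -surjective_pairing valK.
  have := fibre predT v; have -> : #|[set w | adj v w && predT w]| = h.*2.
    by rewrite -(reg v); apply: eq_card => w; rewrite !inE andbT.
  have -> : [set t : T | (tl t == v) && predT (val t).2] = X :|: b @: X.
    apply/setP => t; rewrite !inE andbT; apply/idP/orP => [tv|].
      case tQ : (t \in Q); [by left; rewrite tv|right].
      by apply/imsetP; exists (b t); rewrite ?bK // inE b_fibre tv (QP t).2 tQ.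
    by case=> [/andP[]//|/imsetP[s]]; rewrite inE => /andP[sv _] ->; rewrite b_fibre.
  have XbX : X :&: b @: X = set0.
    apply/setP => t; rewrite !inE; apply/negP => /andP[/andP[_ tQ] /imsetP[s]].
    by rewrite inE => /andP[_ sQ] tE; move: tQ; rewrite tE (QP s).2 sQ.
  by rewrite cardsU XbX cards0 subn0 (card_imset _ (inv_inj bK)) cX; lia.
by split=> //; have := orientation_degree v Oor; rewrite (reg v) outE; lia.
Qed.

(** * Edge labelings as functions of two endpoints *)

Lemma edgesP (G : sgraph) (e : {set G}) :
  reflect (exists u v, adj u v /\ e = [set u; v]) (e \in edges G).
Proof.
rewrite inE; apply: (iffP existsP) => [[u /existsP[v /andP[uv /eqP->]]]|[u [v [uv ->]]]].
  by exists u, v.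
by exists u; apply/existsP; exists v; rewrite uv eqxx.
Qed.

Lemma set2_eq (T : finType) (u v u' v' : T) : [set u; v] = [set u'; v'] ->
  (u = u' /\ v = v') \/ (u = v' /\ v = u').
Proof.
move=> /setP E; have := E u; have := E v; have := E u'; have := E v'.
rewrite !inE !eqxx ?orbT /= => /orP H1 /orP H2 /esym/orP H3 /esym/orP H4.
by case: H1 => /eqP ?; case: H2 => /eqP ?; case: H3 => /eqP ?; case: H4 => /eqP ?;
  subst; auto.
Qed.

Lemma card_arcs (G : sgraph) (O : rel G) : orientation O ->
  #|[set p : G * G | O p.1 p.2]| = #|edges G|.
Proof.
move=> [Oadj ON]; rewrite -(card_in_imset (f := fun p : G * G => [set p.1; p.2])).
  apply: eq_card => e; apply/imsetP/edgesP => [[[u v]]|[u [v [uv ->]]]].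
    by rewrite inE => /Oadj uv ->; exists u, v.
  case uvO : (O u v); first by exists (u, v); rewrite ?inE.
  exists (v, u); last by rewrite setUC.
  by rewrite inE ON ?uvO // adj_sym.
move=> [u v] [u' v']; rewrite !inE /= => uv uv' /set2_eq[[-> ->//]|[E1 E2]].
by move: uv'; rewrite -E1 -E2 ON ?uv // adj_sym; apply: Oadj.
Qed.

Lemma handshake (G : sgraph) : \sum_(v : G) degree v = 2 * #|edges G|.
Proof.
have [O Oor] := orientation_exists G.
under eq_bigr => v _ do rewrite (orientation_degree v Oor) -!sum1dep_card.
rewrite big_split /= [X in _ + X](exchange_big_dep predT) //= addnn -mul2n.
congr (2 * _); rewrite -(card_arcs Oor) -sum1dep_card pair_big_dep /=.
exact: eq_bigl.
Qed.

(** Labels depend on the two endpoints instead of the edge as a set, so that vertex sums become sums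
    over neighbours. Surjectivity onto the interval from 1 to [#|edges G|] follows by counting. *)
Definition edge_labeling (G : sgraph) (L : G -> G -> nat) :=
  [/\ forall u v, adj u v -> L u v = L v u,
      forall u v, adj u v -> 0 < L u v <= #|edges G| &
      forall u v u' v', adj u v -> adj u' v' -> L u v = L u' v' ->
        [set u; v] = [set u'; v']].

Definition weight (G : sgraph) (L : G -> G -> nat) v := \sum_(w | adj v w) L v w.

Lemma edge_labeling_exists (G : sgraph) : exists L : G -> G -> nat, edge_labeling L.
Proof.
have mem_edges u v : @adj G u v -> [set u; v] \in edges G.
  by move=> uv; apply/edgesP; exists u, v.
exists (fun u v => (index [set u; v] (enum (edges G))).+1); split.
- by move=> u v _; rewrite setUC.
- by move=> u v /mem_edges uv; rewrite /= cardE index_mem mem_enum.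
- move=> u v u' v' /mem_edges uv /mem_edges uv' [] E.
  by rewrite -(nth_index set0 (s := enum (edges G)) (x := [set u; v])) ?mem_enum // E
    nth_index ?mem_enum.
Qed.

Lemma edge_labeling_of_arcs (G : sgraph) (O : rel G) (l : G -> G -> nat) :
  orientation O ->
  (forall u v, O u v -> 0 < l u v <= #|edges G|) ->
  (forall u v u' v', O u v -> O u' v' -> l u v = l u' v' -> (u, v) = (u', v')) ->
  exists2 L : G -> G -> nat, edge_labeling L &
    forall v, weight L v = \sum_(w | O v w) l v w + \sum_(w | O w v) l w v.
Proof.
move=> Oor; have [Oadj ON] := Oor => l_bd l_inj.
have ONN u v : O u v -> O v u = false.
  by move=> uv; rewrite ON ?uv // adj_sym Oadj.
pose L u v := if O u v then l u v else if O v u then l v u else 0.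
have adj_or u v : adj u v -> (O u v /\ L u v = l u v) \/ (O v u /\ L u v = l v u).
  rewrite /L => uv; case: ifP => [|uvO]; first by left.
  by have vu : O v u; [rewrite ON ?uvO // adj_sym | rewrite vu; right].
exists L; first split.
- by move=> u v _; rewrite /L; case: ifP => uv; case: ifP => vu //; rewrite ONN in vu.
- by move=> u v /adj_or[[uv ->]|[uv ->]]; apply: l_bd.
- by move=> u v u' v' /adj_or[[uv ->]|[uv ->]] /adj_or[[uv' ->]|[uv' ->]]
    /(l_inj _ _ _ _ uv uv')[-> ->] //; rewrite setUC.
move=> v; rewrite /weight (orientation_sum _ _ Oor); congr (_ + _); apply: eq_bigr => w.
  by rewrite /L => ->.
by move=> wv; rewrite /L ONN // wv.
Qed.

Lemma antimagic_of_labeling (G : sgraph) (L : G -> G -> nat) :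
  edge_labeling L -> injective (weight L) -> antimagic G.
Proof.
move=> [L_sym L_bd L_inj] W_inj.
pose f (e : {set G}) :=
  if [pick p : G * G | adj p.1 p.2 && (e == [set p.1; p.2])] is Some p
  then L p.1 p.2 else 0.
have fE u v : adj u v -> f [set u; v] = L u v.
  move=> uv; rewrite /f; case: pickP => [[u' v']|/(_ (u, v))] /=.
    by move=> /andP[_ /eqP/set2_eq[[<- <-]|[<- <-]]] //; rewrite -(L_sym _ _ uv).
  by rewrite uv eqxx.
have f_inj : {in edges G &, injective f}.
  move=> _ _ /edgesP[u [v [uv ->]]] /edgesP[u' [v' [uv' ->]]].
  by rewrite !fE // => /L_inj; apply.
exists f; split=> // [k|].
  split=> [k_bd|[_ /edgesP[u [v [uv ->]]] <-]]; last by rewrite fE // L_bd.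
  pose s := [seq f e | e <- enum (edges G)].
  (* As many distinct values as the interval has elements exhaust it. *)
  have s_iota : perm_eq s (iota 1 #|edges G|).
    have s_uniq : uniq s.
      rewrite map_inj_in_uniq ?enum_uniq // => e e'; rewrite !mem_enum; exact: f_inj.
    apply: uniq_perm (iota_uniq _ _) _ => //.
    apply: (uniq_min_size s_uniq _ _).2; last by rewrite size_iota size_map -cardE.
    move=> _ /mapP[e + ->]; rewrite mem_enum => /edgesP[u [v [uv ->]]].
    by rewrite mem_iota fE // add1n ltnS L_bd.
  have : k \in s by rewrite (perm_mem s_iota) mem_iota add1n ltnS.
  by case/mapP => e; rewrite mem_enum => eG ->; exists e.
suff fW : vertex_sum f =1 weight L by move=> u v; rewrite !fW; apply: W_inj.
move=> v; rewrite /vertex_sum /weight.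
pose h w := [set v; w].
transitivity (\sum_(w | adj v w) f (h w)); last by apply: eq_bigr => w /fE.
have h_inj : {in [pred w | adj v w] &, injective h}.
  move=> w w'; rewrite !inE => vw vw' /set2_eq[[]//|[E1 E2]].
  by move: vw; rewrite E2 adj_irrefl.
transitivity (\sum_(e in h @: [set w | adj v w]) f e).
  apply: eq_bigl => e; apply/andP/imsetP => [[/edgesP[u [w [uw ->]]]]|[w]].
    rewrite !inE => /orP[/eqP vu|/eqP vw].
      by exists w; rewrite ?inE /h vu.
    by exists u; rewrite ?inE /h vw 1?setUC // adj_sym.
  rewrite inE => vw ->; split; last by rewrite !inE eqxx.
  by apply/edgesP; exists v, w.
rewrite big_imset /=; first by apply: eq_bigl => w; rewrite inE.
by move=> w w'; rewrite !inE; apply: h_inj.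
Qed.

(** * Cartesian products *)

(** The rank counts predecessors in the strict total order that compares [S] first and breaks ties
    by the enumeration of [T]. *)
Lemma sorting_rank (T : finType) (S : T -> nat) : exists r : T -> nat,
  [/\ injective r, forall t, r t < #|T| & forall s t, r s < r t -> S s <= S t].
Proof.
pose e (t : T) : nat := enum_rank t.
have e_inj : injective e by move=> s t /val_inj/enum_rank_inj.
pose lt s t := (S s < S t) || (S s == S t) && (e s < e t).
pose r t := #|[set s | lt s t]|.
have mono s t : lt s t -> r s < r t.
  move=> st; apply: proper_card; apply/properP; split.
    by apply/subsetP => u; rewrite !inE; move: st; rewrite /lt; lia.
  by exists s; rewrite !inE // /lt; lia.
have tot s t : s != t -> lt s t || lt t s.
  by rewrite -(inj_eq e_inj) /lt; lia.
exists r; split.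
- move=> s t rst; apply/eqP; apply: contraT => /tot/orP[]/mono; lia.
- move=> t; rewrite -[X in _ < X]cardsT; apply: proper_card; apply/properP; split=> //.
  by exists t; rewrite !inE // /lt; lia.
- move=> s t rst; rewrite leqNgt; apply/negP => ts.
  by have /mono : lt t s; [rewrite /lt ts | lia].
Qed.

Lemma cart_sum (G1 G2 : sgraph) (F : G1 * G2 -> nat) (p : G1 * G2) :
  \sum_(q | @adj (cart_prod G1 G2) p q) F q =
  \sum_(v | adj p.2 v) F (p.1, v) + \sum_(u | adj p.1 u) F (u, p.2).
Proof.
case: p => u v /=; rewrite (bigID (fun q : G1 * G2 => q.1 == u)) /=; congr (_ + _).
  rewrite (reindex_onto (fun w => (u, w)) (fun q : G1 * G2 => q.2)) /=.
    by apply: eq_bigl => w; rewrite /cart_adj /= !eqxx adj_irrefl andbF orbF !andbT.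
  by move=> [u' v'] /= /andP[_ /eqP->].
rewrite (reindex_onto (fun w => (w, v)) (fun q : G1 * G2 => q.1)) /=.
  apply: eq_bigl => w; rewrite /cart_adj /= !eqxx adj_irrefl andbF andbT /=.
  by rewrite andb_idr // => uw; apply: contraTneq uw => ->; rewrite adj_irrefl.
move=> [u' v'] /= /andP[/orP[/andP[/eqP/= -> _]|/andP[/eqP/= -> //]]].
by rewrite eqxx.
Qed.

Lemma cart_card_edges (G1 G2 : sgraph) :
  #|edges (cart_prod G1 G2)| = #|G1| * #|edges G2| + #|G2| * #|edges G1|.
Proof.
apply/eqP; rewrite -(eqn_pmul2l (isT : 0 < 2)) -handshake; apply/eqP.
transitivity (\sum_(p : G1 * G2) (degree p.2 + degree p.1)).
  apply: eq_bigr => p _; rewrite /degree -sum1dep_card -!sum1dep_card.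
  exact: (cart_sum (fun=> 1)).
rewrite -(pair_bigA_idem _ (fun u v => degree v + degree u)) //=.
under eq_bigr => u _ do rewrite big_split /= sum_nat_const handshake.
rewrite big_split /= sum_nat_const -big_distrr /= handshake.
by rewrite mulnDr !(mulnCA 2).
Qed.

Lemma mixed_radix_inj n a b a' b' : b < n -> b' < n -> n * a + b = n * a' + b' ->
  a = a' /\ b = b'.
Proof.
move=> b_lt b'_lt; have n_gt0 : 0 < n by lia.
rewrite ![n * _]mulnC => E; move: (E) => /(congr1 (divn^~ n)).
rewrite !divnMDl // !divn_small // !addn0 => aa; split=> //.
by move: E; rewrite aa => /addnI.
Qed.

(** One step up in [r2] raises the sum by at least [k1 * #|edges G1|], while the terms that depend
    on the vertex of [G1] can lower it by at most [k2 * #|G1|.-1] through [r1] and by [D / 2]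
    through [weight L1]. Doubling avoids halves. *)
Lemma cart_prod_antimagic (G1 G2 : sgraph) k1 k2 D (L1 : G1 -> G1 -> nat) :
  regular G1 k1 -> max_degree_le G2 k2 -> min_degree_ge G2 1 ->
  edge_labeling L1 -> (forall u u', 2 * weight L1 u <= 2 * weight L1 u' + D) ->
  D + 2 * k2 * #|G1|.-1 < 2 * k1 * #|edges G1| ->
  antimagic (cart_prod G1 G2).
Proof.
move=> reg maxd mind [L1_sym L1_bd L1_inj] spread gap.
have [L2 [L2_sym L2_bd L2_inj]] := edge_labeling_exists G2.
set n := #|G1| in gap *; set m1 := #|edges G1| in gap L1_bd *.
pose m2 := #|edges G2|.
have [r1 [r1_inj r1_lt r1_mono]] := sorting_rank (weight L1).
(* The contribution of the [G2]-type edges at [(u, v)] is [b v + degree v * r1 u]; only [b v]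
   matters for ranking the copies of [G1]. *)
pose b v := \sum_(w | adj v w) (1 + n * (L2 v w).-1).
have [r2 [r2_inj r2_lt r2_mono]] := sorting_rank b.
pose L (p q : cart_prod G1 G2) :=
  if p.1 == q.1 then 1 + n * (L2 p.2 q.2).-1 + r1 p.1
  else n * m2 + m1 * r2 p.2 + L1 p.1 q.1.
have LE (p q : cart_prod G1 G2) : adj p q ->
    (p.1 = q.1 /\ adj p.2 q.2 /\ L p q = 1 + n * (L2 p.2 q.2).-1 + r1 p.1) \/
    (p.2 = q.2 /\ adj p.1 q.1 /\ L p q = n * m2 + m1 * r2 p.2 + L1 p.1 q.1).
  rewrite /= /cart_adj /L; case/orP => /andP[/eqP E a]; first by left; rewrite E eqxx.
  by right; split=> //; split=> //; case: eqP a => // ->; rewrite adj_irrefl.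
have small (p q : cart_prod G1 G2) : adj p.2 q.2 ->
    1 + n * (L2 p.2 q.2).-1 + r1 p.1 <= n * m2.
  move=> /L2_bd/andP[L_gt0 L_le]; have := r1_lt p.1; rewrite -/n => r_lt.
  have : n * (L2 p.2 q.2).-1.+1 <= n * m2 by rewrite leq_mul2l prednK ?L_le ?orbT.
  by rewrite mulnS; lia.
pose n2 := #|G2|; have {}r1_lt u : r1 u < n := r1_lt u.
have {}r2_lt v : r2 v < n2 := r2_lt v.
have cE : #|edges (cart_prod G1 G2)| = n * m2 + m1 * n2.
  by rewrite cart_card_edges [X in _ + X]mulnC.
have irr2 (v v' : G2) : v = v' -> adj v v' = false by move=> ->; apply: adj_irrefl.
have irr1 (u u' : G1) : u = u' -> adj u u' = false by move=> ->; apply: adj_irrefl.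
apply: (@antimagic_of_labeling _ L).
  split.
  - move=> p q pq; have qp : adj q p by rewrite adj_sym.
    case: (LE _ _ pq) => [[E [a ->]]|[E [a ->]]];
    case: (LE _ _ qp) => [[E' [a' ->]]|[E' [a' ->]]].
    + by rewrite E (L2_sym _ _ a).
    + by rewrite irr2 in a.
    + by rewrite irr1 in a.
    + by rewrite E (L1_sym _ _ a).
  - move=> p q /LE[[_ [a ->]]|[_ [a ->]]]; rewrite cE.
      by have := small p q a; rewrite !addSn ltn0Sn => sm; apply: leq_trans sm (leq_addr _ _).
    have := L1_bd _ _ a; have : m1 * (r2 p.2).+1 <= m1 * n2.
      by rewrite leq_mul2l r2_lt orbT.
    by rewrite mulnS; lia.
  - move=> [u v] [u1 v1] [u' v'] [u1' v1'].
    move=> /LE[[/= <- [a ->]]|[/= <- [a ->]]] /LE[[/= <- [a' ->]]|[/= <- [a' ->]]] E.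
    + have [|||j_eq r_eq] := @mixed_radix_inj n (L2 v v1).-1 (r1 u) (L2 v' v1').-1 (r1 u').
      * exact: r1_lt.
      * exact: r1_lt.
      * by lia.
      move/r1_inj: r_eq => <-.
      have /L2_inj : L2 v v1 = L2 v' v1' by have := L2_bd _ _ a; have := L2_bd _ _ a'; lia.
      by move=> /(_ a a')/set2_eq[[<- <-]|[<- <-]] //; rewrite setUC.
    + by have := small (u, v) (u1, v1) a; have := L1_bd _ _ a'; move: E => /=; lia.
    + by have := small (u', v') (u1', v1') a'; have := L1_bd _ _ a; move: E => /=; lia.
    + have := L1_bd _ _ a; have := L1_bd _ _ a' => bd' bd.
      have [|||r_eq l_eq] := @mixed_radix_inj m1 (r2 v) (L1 u u1).-1 (r2 v') (L1 u' u1').-1.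
      * by lia.
      * by lia.
      * by lia.
      move/r2_inj: r_eq => <-.
      have /L1_inj : L1 u u1 = L1 u' u1' by lia.
      by move=> /(_ a a')/set2_eq[[<- <-]|[<- <-]] //; rewrite setUC.
have WE (p : cart_prod G1 G2) : weight L p =
    b p.2 + degree p.2 * r1 p.1 + k1 * (n * m2 + m1 * r2 p.2) + weight L1 p.1.
  rewrite {1}/weight cart_sum -addnA; congr (_ + _).
    rewrite /L /= eqxx big_split /=; congr (_ + _).
    by rewrite /degree -sum1dep_card big_distrl; apply: eq_bigr => v _; rewrite /= mul1n.
  rewrite -(reg p.1) /degree -sum1dep_card big_distrl /= -big_split.
  apply: eq_bigr => u pu; rewrite /L /= mul1n.
  by case: eqP pu => // ->; rewrite adj_irrefl.
(* Strictness comes from the term [degree q.2 * r1], the degree being positive; [weight L1] only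
   increases weakly with the rank. *)
have W_lt1 (p q : cart_prod G1 G2) : p.2 = q.2 -> r1 p.1 < r1 q.1 -> weight L p < weight L q.
  move=> E r_lt; rewrite !WE E; have := r1_mono _ _ r_lt; have := mind q.2.
  have : degree q.2 * (r1 p.1).+1 <= degree q.2 * r1 q.1 by rewrite leq_mul2l r_lt orbT.
  by rewrite mulnS; lia.
have W_lt2 (p q : cart_prod G1 G2) : r2 p.2 < r2 q.2 -> weight L p < weight L q.
  move=> r_lt; rewrite !WE; have := r2_mono _ _ r_lt; have := spread p.1 q.1.
  have : degree p.2 * r1 p.1 <= k2 * n.-1.
    by apply: leq_mul; [apply: maxd | have := r1_lt p.1; lia].
  have : k1 * m1 * (r2 p.2).+1 <= k1 * m1 * r2 q.2 by rewrite leq_mul2l r_lt orbT.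
  rewrite mulnS !mulnDr !mulnA; move: gap; rewrite -!mulnA.
  move: (k2 * _) (k1 * _) (k1 * _) (k1 * _) => *; lia.
move=> p q Wpq; have E2 : p.2 = q.2.
  by apply: r2_inj; case: (ltngtP (r2 p.2) (r2 q.2)) => // /W_lt2; rewrite Wpq ltnn.
have E1 : p.1 = q.1.
  apply: r1_inj; case: (ltngtP (r1 p.1) (r1 q.1)) => // lt.
    by have := W_lt1 _ _ E2 lt; rewrite Wpq ltnn.
  by have := W_lt1 _ _ (esym E2) lt; rewrite Wpq ltnn.
by rewrite [p]surjective_pairing [q]surjective_pairing E1 E2.
Qed.

(** * Labelings of regular graphs with nearly constant weights *)

(** Exactly one of the out-degree and the in-degree of a vertex is odd, so [k.-1] labels at the
    vertex are paired and a single one ranges freely from 1 to [#|edges G|]. The [+ 2] on the left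
    stands for the free label being at least 1. *)
Lemma odd_regular_labeling (G : sgraph) k : regular G k -> odd k ->
  exists2 L : G -> G -> nat, edge_labeling L &
    forall u u', 2 * weight L u + 2 <= 2 * weight L u' + (3 * k.-1 + 2 * #|edges G|).
Proof.
move=> reg kodd; have [O Oor] := orientation_exists G.
have [l [C [l_inj l_bd out_bal in_bal]]] := balanced_arc_labeling O.
rewrite (card_arcs Oor) in l_bd out_bal in_bal.
have [L LG LW] := edge_labeling_of_arcs Oor l_bd l_inj.
exists L => // u u'.
have bd v : k.-1 * C + 2 <= 2 * weight L v <= k.-1 * (C + 3) + 2 * #|edges G|.
  rewrite LW mulnDr.
  have := out_bal v _ erefl; have := in_bal v _ erefl.
  have := orientation_degree v Oor; rewrite (reg v).
  move: #|[set w | O v w]| #|[set w | O w v]| => a b kab.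
  move: (2 * \sum_(w | O v w) _) (2 * \sum_(w | O w v) _) (2 * #|_|) => S1 S2 m.
  have -> : k.-1 = (a - odd a) + (b - odd b) by lia.
  rewrite !mulnDl; have : odd a + odd b = 1 by lia.
  by case: (odd a) (odd b) => [] [] //= _; rewrite ?mul0n ?mul1n; lia.
have := bd u; have := bd u'; rewrite mulnDr; lia.
Qed.

(** For [h] even all arcs are paired at both ends, which gives the spread [6 * h]. For [h] odd,
    removing a permutation leaves out- and in-degrees [h.-1], which are even; the labels of the
    permutation add [x v + x (g v)], confined to [#|G|] consecutive values, whence [2 * #|G|.-1]. *)
Lemma even_regular_labeling (G : sgraph) h : regular G h.*2 ->
  exists2 L : G -> G -> nat, edge_labeling L &
    forall u u', 2 * weight L u <= 2 * weight L u' + (2 * #|G|.-1 + 6 * (h - odd h)).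
Proof.
move=> reg; have [O [Oor Odeg]] := eulerian_orientation reg.
have [hodd|heven] := boolP (odd h); last first.
  have [l [C [l_inj l_bd out_bal in_bal]]] := balanced_arc_labeling O.
  rewrite (card_arcs Oor) in l_bd out_bal in_bal.
  have [L LG LW] := edge_labeling_of_arcs Oor l_bd l_inj.
  exists L => // u u'.
  have bd v : 2 * (h * C) <= 2 * weight L v <= 2 * (h * (C + 3)).
    rewrite LW mulnDr.
    have := out_bal v _ (Odeg v).1; have := in_bal v _ (Odeg v).2.
    by rewrite (negPf heven) subn0 mul0n !addn0; lia.
  by have := bd u; have := bd u'; rewrite (mulnDr h); lia.
have [Oadj ON] := Oor.
have [s s_inj sO] := regular_matching (odd_gt0 hodd) (fun v => (Odeg v).1) (fun v => (Odeg v).2).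
have sN v : s v != v by apply: contraTneq (Oadj _ _ (sO v)) => ->; rewrite adj_irrefl.
have [x [Cx [x_inj x_bd x_bal]]] := permutation_labeling s_inj sN.
pose g := finv s; have sg v : s (g v) = v by apply: f_finv.
have gs v : g (s v) = v by apply: finv_f.
have outD (F : G -> nat) v : \sum_(w | O v w) F w =
    F (s v) + \sum_(w | O v w && (w != s v)) F w by rewrite (bigD1 (s v)).
have inD (F : G -> nat) v : \sum_(w | O w v) F w =
    F (g v) + \sum_(w | O w v && (v != s w)) F w.
  rewrite (bigD1 (g v)) /=; last by rewrite -{2}(sg v).
  congr (_ + _); apply: eq_bigl => w; congr (_ && ~~ _).
  by apply/eqP/eqP => ->.
pose A u v := O u v && (v != s u).
have [l [C [l_inj l_bd out_bal in_bal]]] := balanced_arc_labeling A.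
set N := #|_| in l_bd out_bal in_bal.
have outA v : #|[set w | A v w]| = h.-1.
  by rewrite -(Odeg v).1 -!sum1dep_card outD.
have inA v : #|[set w | A w v]| = h.-1.
  by rewrite -(Odeg v).2 -!sum1dep_card inD.
have cN : #|edges G| = #|G| + N.
  rewrite -(card_arcs Oor) /N -!sum1dep_card -(pair_big_dep predT O (fun _ _ => 1)) /=.
  rewrite -(pair_big_dep predT A (fun _ _ => 1)) /= -sum1_card -big_split /=.
  by apply: eq_bigr => v _; rewrite outD.
(* The arcs from [u] to [s u] take the labels 1 to [#|G|], and all others are shifted above them. *)
pose l' u v := if v == s u then x u else #|G| + l u v.
have [||L LG LW] := @edge_labeling_of_arcs G O l' Oor.
- move=> u v uv; rewrite /l' cN; case: eqP => [_|/eqP vs]; first by have := x_bd u; lia.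
  by have := l_bd u v; rewrite /A uv vs => /(_ isT); lia.
- move=> u v u' v' uv uv'; rewrite /l'; case: eqP => [->|/eqP vs]; case: eqP => [->|/eqP vs'].
  + by move=> /x_inj->.
  + by have := l_bd u' v'; rewrite /A uv' vs' => /(_ isT); have := x_bd u; lia.
  + by have := l_bd u v; rewrite /A uv vs => /(_ isT); have := x_bd u'; lia.
  + by move=> /addnI; apply: l_inj; rewrite /A ?uv ?uv'.
exists L => // u u'.
have LW' v : weight L v = x v + x (g v) + 2 * (h.-1 * #|G|)
    + (\sum_(w | A v w) l v w + \sum_(w | A w v) l w v).
  rewrite LW outD inD.
  have -> : \sum_(w | O v w && (w != s v)) l' v w = h.-1 * #|G| + \sum_(w | A v w) l v w.
    rewrite -(outA v) -sum1dep_card big_distrl -big_split.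
    by apply: eq_bigr => w /andP[_ /negPf ws]; rewrite /l' ws /= mul1n.
  have -> : \sum_(w | O w v && (v != s w)) l' w v = h.-1 * #|G| + \sum_(w | A w v) l w v.
    rewrite -(inA v) -sum1dep_card big_distrl -big_split.
    by apply: eq_bigr => w /andP[_ /negPf ws]; rewrite /l' ws /= mul1n.
  by rewrite /l' eqxx sg eqxx; lia.
have bd v : 2 * (h.-1 * C) <= 2 * (\sum_(w | A v w) l v w + \sum_(w | A w v) l w v)
    <= 2 * (h.-1 * (C + 3)).
  rewrite mulnDr; have := out_bal v _ (outA v); have := in_bal v _ (inA v).
  have -> : odd h.-1 = false by lia.
  by rewrite subn0 mul0n !addn0; lia.
have x_bal' v : Cx <= x v + x (g v) < Cx + #|G| by have := x_bal (g v); rewrite sg addnC.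
rewrite !LW'; have := bd u; have := bd u'; have := x_bal' u; have := x_bal' u'.
by rewrite (mulnDr h.-1); lia.
Qed.

(* Both divisions by 2 are exact: k1 ^ 2 - k1 is always even, and k1 ^ 2 is
   even when k1 is. *)
Theorem theorem1p5 (G1 G2 : sgraph) (n1 k1 k2 : nat)
  (hn1 : #|G1| = n1)
  (hreg : regular G1 k1)
  (hmax : max_degree_le G2 k2)
  (hmin : min_degree_ge G2 1)
  (hk : (odd k1 /\ k2 <= (k1 ^ 2 - k1) %/ 2) \/
        (~~ odd k1 /\ k2 < k1 ^ 2 %/ 2)) :
  antimagic (cart_prod G1 G2).
Proof.
(* On an empty product any labeling has distinct vertex sums. *)
have [/pred0P V0|/pred0Pn[[u0 v0] _]] := boolP (pred0b (@predT (G1 * G2))).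
  have [L LG] := edge_labeling_exists (cart_prod G1 G2).
  by apply: (antimagic_of_labeling LG) => p; have := V0 p.
have k2_gt0 : 0 < k2 by apply: leq_trans (hmin v0) (hmax v0).
have n_gt0 : 0 < #|G1| by apply/card_gt0P; exists u0.
have m1E : 2 * #|edges G1| = #|G1| * k1.
  rewrite -handshake (eq_bigr (fun=> k1)) => [|u _]; last exact: hreg.
  by rewrite sum_nat_const.
have gapE : 2 * k1 * #|edges G1| = #|G1| * (k1 * k1) by rewrite -mulnA mulnCA m1E; lia.
have [k1odd|k1even] := boolP (odd k1).
  have {hk} hk : 2 * k2 + k1 <= k1 * k1 by case: hk => [[_]|[/negP//]]; lia.
  have [L LG spread] := odd_regular_labeling hreg k1odd.
  apply: (cart_prod_antimagic (D := 3 * k1.-1 + 2 * #|edges G1| - 2) hreg hmax hmin LG).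
    by move=> u u'; have := spread u u'; lia.
  rewrite gapE m1E; case: #|G1| n_gt0 => // N _ /=.
  (* With [#|G1| = N + 1], this pays for the terms in [N]. What remains is [4 * k1 - 5 < k1 * k1],
     which follows from [(k1 - 2) ^ 2] being nonnegative. *)
  have : (2 * k2 + k1) * N <= k1 * k1 * N by rewrite leq_mul2r hk orbT.
  have : 4 * k1 <= k1 * k1 + 4 by nia.
  by lia.
have {hk} hk : 2 * k2 + 2 <= k1 * k1 by case: hk => [[/(negP k1even)]//|[_]]; lia.
have hE : k1 = (k1./2).*2 by lia.
move: (k1./2) hE hreg hk gapE => h -> hreg hk gapE.
have [L LG spread] := even_regular_labeling hreg.
apply: (cart_prod_antimagic hreg hmax hmin LG spread).
rewrite gapE; case: #|G1| n_gt0 => // N _ /=.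
have : (2 * k2 + 2) * N <= h.*2 * h.*2 * N by rewrite leq_mul2r hk orbT.
(* [h] is positive by [hk]. The correction [odd h] matters for [h = 1], where [6 * h] would exceed
   the right-hand side 4. *)
have : 6 * (h - odd h) < h.*2 * h.*2 by nia.
by lia.
Qed.
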